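(* For every real $\alpha>0$ and every integer $k\geq 3$ there exist $\epsilon>0$ and $n_0$ such that if $G$ is a $k$-uniform hypergraph on $n\geq n_0$ vertices with $e(G)>(1-\epsilon)\binom{n}{k}$, then (1) $\mathrm{mc}_k(G)\geq (1-\alpha)n$, and (2) $\mathrm{mc}_{k+1}(G)\geq \left(\frac{k}{k+1}-\alpha\right)n$.
   Context: A hypergraph $H=(V,E)$ is connected if its shadow graph (vertex set $V$, with $\{x,y\}$ an edge whenever $\{x,y\}\subseteq e$ for some $e\in E$) is connected; a component is a maximal connected subhypergraph, and its order is its number of vertices. For an $r$-coloring $\chi:E(H)\to[r]$ of the edges, a monochromatic component is a component of the subhypergraph formed by the edges of one color; $\mathrm{mc}(H,\chi)$ is the largest order of a monochromatic component, and $\mathrm{mc}_r(H)=\min_{\chi}\mathrm{mc}(H,\chi)$ over all $r$-colorings $\chi$. $e(G)$ denotes the number of edges of $G$. *)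

(* Defs.v *)
From HB Require Import structures.
From mathcomp Require Import all_boot all_order all_algebra.
From mathcomp Require Import reals.

Set Implicit Arguments.
Unset Strict Implicit.
Unset Printing Implicit Defensive.

(* A pair (vertex set, edge set) whose edges are subsets of the vertex set. *)
Record hypergraph (T : finType) := Hypergraph {
  hgval :> {set T} * {set {set T}};
  hgvalP : cover hgval.2 \subset hgval.1 }.

HB.instance Definition _ (T : finType) := [isSub for @hgval T].
HB.instance Definition _ (T : finType) := [Finite of hypergraph T by <:].

Section Hypergraphs.
Variable T : finType.
Implicit Types (G H K : hypergraph T).

Definition vertices H : {set T} := H.1.
Definition edges H : {set {set T}} := H.2.

Definition uniform (k : nat) H : bool := [forall e in edges H, #|e| == k].

Definition shadow H : rel T :=
  fun x y => (x != y) && [exists e in edges H, [set x; y] \subset e].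

(* The empty hypergraph counts as connected; this has no effect on the largest
   order of a component. *)
Definition connected H : bool :=
  [forall x in vertices H, forall y in vertices H, connect (shadow H) x y].

Definition subhypergraph K H : bool :=
  (vertices K \subset vertices H) && (edges K \subset edges H).

Definition component H K : bool :=
  [&& subhypergraph K H, connected K &
      [forall L : hypergraph T,
         [&& subhypergraph L H, connected L & subhypergraph K L] ==> (L == K)]].

Definition coloring (r : nat) H := {ffun {e | e \in edges H} -> 'I_r}.

Definition color_class (r : nat) H (chi : coloring r H) (i : 'I_r) :
    {set {set T}} :=
  [set val e | e : {e | e \in edges H} & chi e == i].

Definition color_subhypergraph (r : nat) H (chi : coloring r H) (i : 'I_r) :
    hypergraph T :=
  @Hypergraph T (cover (color_class chi i), color_class chi i) (subxx _).

Definition mc (r : nat) H (chi : coloring r H) : nat :=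
  \max_(i < r) \max_(K | component (color_subhypergraph chi i) K) #|vertices K|.

(* Since mc chi <= #|vertices H| for every chi, the default value of the big
   operator does not affect the minimum when a coloring exists (r > 0). *)
Definition mc_min (r : nat) H : nat :=
  \big[minn/#|vertices H|]_(chi : coloring r H) mc chi.

End Hypergraphs.

(* Main.v *)
(* The components of each color are merged into two sides, each within the
   admissible component size, so that every vertex gets a word in {0,1}^r and
   no edge carries words that differ somewhere in every coordinate. If k words,
   each carried by at least delta n vertices, split every coordinate, then
   there are at least (delta n)^k - O(n^(k-1)) k-tuples that are non-edges,
   contradicting the density. Otherwise the popular words have Hamming
   diameter at most r - k + 1, while no coordinate is constant on them. For
   r = k this is impossible. For r = k + 1 >= 4 it forces the popular words
   into a Hamming ball of radius 1; each popular vertex differs from the center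
   in at most one coordinate, so for some color at most a 1/(k+1) fraction of
   the vertices lies on the side away from the center. *)

Require Import Defs.
From mathcomp Require Import all_boot all_order all_algebra.
From mathcomp Require Import reals.
From mathcomp Require Import zify ring lra.
Import Order.TTheory GRing.Theory Num.Theory.
Set Implicit Arguments.
Unset Strict Implicit.
Unset Printing Implicit Defensive.

(** * Binary words under the Hamming distance *)

Section Words.
Variable I : finType.
Implicit Types (x y z u v : {ffun I -> bool}) (C : {set {ffun I -> bool}}).

Definition differ x y : {set I} := [set i | x i != y i].

(** An edge is constant in the coordinate of its color, so vertices carrying splitting words never
    form an edge. *)
Definition splits (k : nat) (w : {ffun 'I_k -> {ffun I -> bool}}) : Prop :=
  forall i, exists j j', w j i != w j' i.

Definition nonconstant C : Prop := forall i b, exists2 z, z \in C & z i = b.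

Lemma differC x y : differ x y = differ y x.
Proof. by apply/setP=> i; rewrite !inE eq_sym. Qed.

(* Take [x], [y], and for each coordinate where they agree one further word
   disagreeing with [x] there. *)
Lemma splits_of_agreement C k x y :
    nonconstant C -> x \in C -> y \in C -> #|~: differ x y|.+2 <= k ->
  exists2 w : {ffun 'I_k -> {ffun I -> bool}},
    forall j, w j \in C & splits w.
Proof.
move=> ncC Cx Cy le_k.
have [zf zfP] : exists zf : I -> {ffun I -> bool},
    forall i, zf i \in C /\ zf i i != x i.
  have P i : exists z, (z \in C) && (z i != x i).
    by have [z Cz zi] := ncC i (~~ x i); exists z; rewrite Cz zi; case: (x i).
  by exists (fun i => xchoose (P i)) => i; apply/andP; exact: (xchooseP (P i)).
pose s := x :: y :: [seq zf i | i <- enum (~: differ x y)].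
have szs : size s <= k by rewrite /= size_map -cardE.
have sC z : z \in s -> z \in C.
  by rewrite !inE => /or3P[/eqP->|/eqP->|/mapP[i _ ->]] //; case: (zfP i).
(* Positions beyond [s] default to [x], so a list shorter than [k] is padded within [C]. *)
exists [ffun j : 'I_k => nth x s j].
  move=> j; rewrite ffunE; have [lt|ge] := ltnP j (size s).
    by apply: sC; rewrite mem_nth.
  by rewrite nth_default.
have s_w z : z \in s -> exists j, [ffun j : 'I_k => nth x s j] j = z.
  move=> sz; have lt : index z s < k.
    by apply: leq_trans szs; rewrite index_mem.
  by exists (Ordinal lt); rewrite ffunE nth_index.
move=> i; have [jx Ex] := s_w x (mem_head _ _).
have [i_d|i_d] := boolP (i \in differ x y).
  have [|jy Ey] := s_w y; first by rewrite !inE eqxx orbT.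
  by exists jx, jy; rewrite Ex Ey; rewrite inE in i_d.
have [|jz Ez] := s_w (zf i).
  by rewrite !inE map_f ?orbT // mem_enum inE.
by exists jz, jx; rewrite Ex Ez; case: (zfP i).
Qed.

Lemma differ_le2 x y i j l :
    #|differ x y| <= 2 -> uniq [:: i; j; l] ->
  x i != y i -> x j != y j -> x l = y l.
Proof.
move=> le2 un xi xj; apply/eqP; apply: contraLR le2 => xl; rewrite -ltnNge.
have <- : #|[set z in [:: i; j; l]]| = 3 by rewrite cardsE (card_uniqP un).
apply/subset_leq_card/subsetP=> z.
by rewrite !inE => /or3P[] /eqP->.
Qed.

(** Unless [x] is itself a center, some [y] flips two of its coordinates, [a] and [b]. Words
    flipping two further coordinates [p] and [q] must also flip [a] or [b], and one of these flips
    is common to both; applying it to [x] gives the center. Three coordinates would not do: 000,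
    011, 101, 110. *)
Lemma diameter2_ball C :
    4 <= #|I| -> nonconstant C ->
    (forall x y, x \in C -> y \in C -> #|differ x y| <= 2) ->
  exists c, forall x, x \in C -> #|differ x c| <= 1.
Proof.
move=> I4 ncC diam.
have fresh (s : seq I) : size s < 4 -> exists i, i \notin s.
  move=> s4; have : ~~ (setT \subset [set i in s]).
    apply: contraL s4 => /subset_leq_card; rewrite cardsT cardsE => le.
    by rewrite -leqNgt (leq_trans I4) // (leq_trans le) // card_size.
  by case/subsetPn=> i _; rewrite inE; exists i.
have [i0 _] := fresh [::] isT; have [x Cx _] := ncC i0 true.
have [/exists_inP[y Cy /card_gt1P[a [b [ya yb ab]]]]|noy] :=
  boolP [exists y in C, 1 < #|differ x y|]; last first.
  exists x => y Cy; rewrite leqNgt differC.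
  by apply: contra noy => gt1; apply/exists_inP; exists y.
have three u v i j l : u \in C -> v \in C -> i != j -> i != l -> j != l ->
    u i != v i -> u j != v j -> u l = v l.
  move=> Cu Cv ij il jl; apply: differ_le2; first exact: diam.
  by rewrite /= !inE negb_or ij il jl.
rewrite !inE in ya yb.
have [p] := fresh [:: a; b] isT; rewrite !inE negb_or => /andP[pa pb].
have [q] := fresh [:: a; b; p] isT.
rewrite !inE !negb_or => /and3P[qa qb qp].
have [z Cz zp] := ncC p (~~ x p); have [u Cu uq] := ncC q (~~ x q).
have {}zp : x p != z p by rewrite zp; case: (x p).
have {}uq : x q != u q by rewrite uq; case: (x q).
(* If [y], [z], [u] arise from [x] by flipping coordinate [a] and one further
   coordinate each, then [x] with [a] flipped is the center. *)
have center a' b' p' q' y' z' u' :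
    [&& a' != b', a' != p', a' != q', b' != p', b' != q' & p' != q'] ->
    y' \in C -> z' \in C -> u' \in C ->
    x a' != y' a' -> x b' != y' b' -> x a' != z' a' -> x p' != z' p' ->
    x a' != u' a' -> x q' != u' q' ->
  exists c, forall x, x \in C -> #|differ x c| <= 1.
  case/and5P=> ab' ap' aq' bp' /andP[bq' pq'] Cy' Cz' Cu'.
  move=> ya' yb' za' zp' ua' uq'.
  exists [ffun i => if i == a' then ~~ x a' else x i] => v Cv.
  have no3 i1 i2 i3 : i1 != i2 -> i1 != i3 -> i2 != i3 ->
      x i1 != v i1 -> x i2 != v i2 -> x i3 != v i3 -> False.
    move=> i12 i13 i23 v1 v2 /eqP[].
    exact: (three x v i1 i2).
  (* If [v] keeps [a'] but flips [j], it already differs from [y1] at [a'] and [j], so it agrees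
     with [y1] at [b1]. *)
  have forced b1 y1 j : y1 \in C -> x a' != y1 a' -> x b1 != y1 b1 ->
      a' != b1 -> v a' = x a' -> x j != v j -> j != b1 -> x b1 != v b1.
    move=> Cy1 y1a y1b ab1 va vj jb.
    have ja : a' != j by apply: contraNneq vj => <-; rewrite va.
    have y1j : x j = y1 j by apply: (three _ _ a' b1); rewrite // eq_sym.
    rewrite [v b1](three v y1 a' j) //; first by rewrite va.
    by rewrite -y1j eq_sym.
  (* A single flip by such a [v] would force flips at all of [b'], [p'], [q'], hence at least
     three. *)
  have va_x : v a' = x a' -> forall j, v j = x j.
    move=> va j; apply/eqP; rewrite eq_sym; apply/negPn/negP=> vj.
    have fb := forced b' y' j Cy' ya' yb' ab' va vj.
    have fp := forced p' z' j Cz' za' zp' ap' va vj.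
    have fq := forced q' u' j Cu' ua' uq' aq' va vj.
    case: (eqVneq j b') => [E|jb]; first subst b'.
      by apply: (no3 j p' q') => //; auto.
    case: (eqVneq j p') => [E|jp]; first subst p'.
      by apply: (no3 j b' q'); rewrite ?fb ?fq // eq_sym.
    by apply: (no3 j b' p'); auto.
  apply/card_le1_eqP=> i j; rewrite !inE !ffunE => vi vj.
  case: (eqVneq (v a') (x a')) => [va|va].
    move: vi vj; rewrite (va_x va i) (va_x va j).
    case: (eqVneq i a') => [->|_]; last by rewrite eqxx.
    by case: (eqVneq j a') => [->|_]; last by rewrite eqxx.
  (* Here [v] flips [a'] as the center does, which leaves it at most one further flip. *)
  have notc : (v a' != ~~ x a') = false by case: (v a') (x a') va => [] [].
  have off l : (v l != if l == a' then ~~ x a' else x l) ->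
      a' != l /\ x l != v l.
    case: (eqVneq l a') => [->|la]; first by rewrite notc.
    by rewrite eq_sym.
  have [[ai xi] [aj xj]] := (off i vi, off j vj).
  apply/eqP/negPn/negP=> ij.
  by apply: (no3 a' i j); rewrite // eq_sym.
rewrite eq_sym in pa; rewrite eq_sym in pb; rewrite eq_sym in qa.
rewrite eq_sym in qb; rewrite eq_sym in qp.
have xp : x p = y p by apply: (three x y a b); rewrite // eq_sym.
have xq : x q = y q by apply: (three x y a b); rewrite // eq_sym.
(* Otherwise [w] and [y] would differ at [a], [b] and [r]. *)
have one_of w r : w \in C -> a != r -> b != r -> x r = y r -> x r != w r ->
    x a != w a \/ x b != w b.
  move=> Cw ar br xr wr; case: (eqVneq (x a) (w a)) => wa; last by left.
  right; apply: contraNneq wr => wb; rewrite xr; apply/eqP.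
  by apply: (three y w a b); rewrite // -?wa -?wb eq_sym.
(* With flips [a1], [p] in [z] and [b1], [q] in [u], the words [z] and [u] would differ at [a1],
   [b1] and [p]. *)
have cross a1 b1 : a1 != b1 -> a1 != p -> b1 != p -> b1 != q -> p != q ->
    x a1 != z a1 -> x b1 = z b1 -> x a1 = u a1 -> x b1 != u b1 -> False.
  move=> ab1 ap bp bq pq za zb ua ub; case/eqP: zp.
  have -> : x p = u p by apply: (three _ _ b1 q); rewrite // eq_sym.
  by apply: (three _ _ a1 b1); rewrite -?ua -?zb // eq_sym.
have ab' : b != a by rewrite eq_sym.
have [ua|ua] := eqVneq (x a) (u a); have [zb|zb] := eqVneq (x b) (z b).
- have [|ub] := one_of u q Cu qa qb xq uq; first by rewrite ua eqxx.
  have [za|] := one_of z p Cz pa pb xp zp; last by rewrite zb eqxx.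
  by case: (cross a b).
- have [|ub] := one_of u q Cu qa qb xq uq; first by rewrite ua eqxx.
  by apply: (center b a p q y z u); rewrite ?ab' ?pa ?pb ?qa ?qb.
- have [za|] := one_of z p Cz pa pb xp zp; last by rewrite zb eqxx.
  by apply: (center a b p q y z u); rewrite ?ab ?pa ?pb ?qa ?qb.
have [za|za] := eqVneq (x a) (z a); last first.
  by apply: (center a b p q y z u); rewrite ?ab ?pa ?pb ?qa ?qb.
have [ub|ub] := eqVneq (x b) (u b); last first.
  by apply: (center b a p q y z u); rewrite ?ab' ?pa ?pb ?qa ?qb.
by case: (cross b a).
Qed.

(** If [y] flips coordinate [i] of [x] and [z] flips [j], each flips nothing else, so [y] and [z]
    differ in both. *)
Lemma diameter1_not_nonconstant C :
    2 <= #|I| -> (forall x y, x \in C -> y \in C -> #|differ x y| <= 1) ->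
  ~ nonconstant C.
Proof.
move=> /card_gt1P[i [j [_ _ ij]]] diam ncC.
have [x Cx xi] := ncC i true.
have [y Cy yi] := ncC i false; have [z Cz zj] := ncC j (~~ x j).
have one u v l l' : u \in C -> v \in C -> u l != v l -> u l' != v l' -> l = l'.
  by move=> Cu Cv ul ul'; apply: (card_le1_eqP (diam u v Cu Cv)); rewrite inE.
have xyi : x i != y i by rewrite xi yi.
have xzj : x j != z j by rewrite zj; case: (x j).
have zi : x i = z i.
  by apply/eqP/negPn/negP=> xzi; rewrite (one x z i j) ?eqxx in ij.
have yj : x j = y j.
  by apply/eqP/negPn/negP=> xyj; rewrite (one x y i j) ?eqxx in ij.
by rewrite (one y z i j) ?eqxx // -?zi -?yj // eq_sym in ij.
Qed.

(** A pair farther apart agrees in at most [k - 2] coordinates, so its splitting family fits into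
    [k] words. *)
Lemma no_split_diameter C k :
    1 < k -> nonconstant C ->
    (forall w : {ffun 'I_k -> {ffun I -> bool}},
       (forall j, w j \in C) -> ~ splits w) ->
  forall x y, x \in C -> y \in C -> #|differ x y| <= #|I|.+1 - k.
Proof.
move=> k1 ncC nosplit x y Cx Cy; rewrite leqNgt; apply/negP=> gt.
have [|w Cw] := @splits_of_agreement C k x y ncC Cx Cy; last exact: nosplit.
have := cardsC (differ x y); lia.
Qed.
End Words.

(** * Components of a color and their merging into two sides *)

(** The labels will be the components of one color. The ratio 2/3 is optimal: of three equally heavy
    labels, one side gets at least two. *)
Lemma bisect_labels (T L : finType) (lab : T -> L) (V : {set T}) (b : nat) :
    (forall a, #|[set v in V | lab v == a]| <= b) -> 2 * #|V| <= 3 * b ->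
  exists p : L -> bool, forall s, #|[set v in V | p (lab v) == s]| <= b.
Proof.
move=> small Vb.
pose wt (S : {set L}) := #|[set v in V | lab v \in S]|.
have wtC S : wt S + wt (~: S) = #|V|.
  rewrite -(cardsID [set v | lab v \in S] V); congr (_ + _).
    by apply: eq_card => v; rewrite !inE.
  by apply: eq_card => v; rewrite !inE andbC.
have bisect S : wt S <= b -> wt (~: S) <= b ->
    exists p : L -> bool, forall s, #|[set v in V | p (lab v) == s]| <= b.
  move=> wS wC; exists (fun a => a \in S) => -[].
    by apply: leq_trans wS; apply: eq_leq; apply: eq_card => v; rewrite !inE eqb_id.
  apply: leq_trans wC; apply: eq_leq; apply: eq_card => v.
  by rewrite !inE eqbF_neg.
have wt0 : wt set0 <= b.
  rewrite /wt (_ : [set _ in _ | _] = set0) ?cards0 //.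
  by apply/setP=> v; rewrite !inE andbF.
(* For a heaviest light [S] with heavy complement, any label of positive weight
   outside [S] weighs so much that its singleton bisects. *)
case: (@arg_maxnP _ set0 (fun S => wt S <= b) wt wt0) => S wS maxS.
case: (leqP (wt (~: S)) b) => [|wC]; first exact: bisect.
have /card_gt0P[v] : 0 < wt (~: S) by lia.
rewrite !inE => /andP[Vv vS]; set l := lab v in vS.
have wtU : wt (l |: S) <= wt S + wt [set l].
  apply: leq_trans (leq_card_setU _ _); apply/subset_leq_card/subsetP=> u.
  by rewrite !inE; case: (u \in V) => //=; rewrite orbC.
have wl : wt [set l] <= b.
  by apply: leq_trans (small l); apply: eq_leq; apply: eq_card => u; rewrite !inE.
have ltU : wt S < wt (l |: S).
  apply: proper_card; apply/properP; split.
    by apply/subsetP=> u; rewrite !inE => /andP[-> ->]; rewrite orbT.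
  by exists v; rewrite !inE Vv ?eqxx //= (negPf vS).
have bU : b < wt (l |: S).
  by rewrite ltnNge; apply/negP=> /maxS /=; lia.
(* [wt S + wt [set l] > b] and [wt S < #|V| - b] give [wt [set l] > 2 * b - #|V|], so the rest
   weighs less than [2 * #|V| - 2 * b <= b]. *)
apply: (bisect [set l]) => //.
have := wtC [set l]; have := wtC S; lia.
Qed.

Lemma shadow_sym (T : finType) (H : hypergraph T) : symmetric (shadow H).
Proof. by move=> x y; rewrite /shadow eq_sym setUC. Qed.

Lemma shadowP (T : finType) (H : hypergraph T) x y :
  reflect (x != y /\ exists2 e, e \in edges H & (x \in e) && (y \in e))
          (shadow H x y).
Proof.
apply: (iffP andP) => -[xy].
  case/exists_inP=> e He; rewrite subUset !sub1set => xye.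
  by split=> //; exists e.
case=> e He xye; split=> //; apply/exists_inP.
by exists e; rewrite // subUset !sub1set.
Qed.

Section Components.
Variables (T : finType) (H : hypergraph T).

Lemma edge_vertices e : e \in edges H -> e \subset vertices H.
Proof. by move=> He; apply: subset_trans (hgvalP H); apply: bigcup_sup He. Qed.

Lemma edge_connect e x y :
  e \in edges H -> x \in e -> y \in e -> connect (shadow H) x y.
Proof.
move=> He xe ye; case: (eqVneq x y) => [->|xy]; first exact: connect0.
by apply: connect1; apply/shadowP; split=> //; exists e; rewrite ?xe.
Qed.

Definition connected_class x : {set T} := [set y | connect (shadow H) x y].

Lemma connected_class_edge x e y :
    e \in edges H -> y \in e -> y \in connected_class x ->
  e \subset connected_class x.
Proof.
move=> He ye; rewrite inE => xy; apply/subsetP=> z ze; rewrite inE.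
exact: connect_trans xy (edge_connect He ye ze).
Qed.

Lemma connected_class_vertices (x : T) :
  x \in vertices H -> connected_class x \subset vertices H.
Proof.
move=> xH; apply/subsetP=> y; rewrite inE => /connectP[p].
elim: p x xH => [|z p IH] x xH /=; first by move=> _ ->.
case/andP=> /shadowP[_ [e He /andP[_ ze]]]; apply: IH.
exact: (subsetP (edge_vertices He)).
Qed.

Definition component_at (x : T) : hypergraph T.
Proof.
exists (connected_class x, [set e in edges H | e \subset connected_class x]).
by apply/bigcupsP=> e; rewrite inE => /andP[].
Defined.

(** The edges of a path from [x] stay in its class, so the class is connected on its own; a
    connected [L] above it has only vertices reachable from [x], hence adds nothing. *)
Lemma component_atP (x : T) : x \in vertices H -> component H (component_at x).
Proof.
move=> xH; have sub_con (K : hypergraph T) : subhypergraph K H ->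
    forall y z, connect (shadow K) y z -> connect (shadow H) y z.
  case/andP=> _ /subsetP sE; apply: connect_sub => y z.
  case/shadowP=> _ [e Ke /andP[ye ze]].
  exact: edge_connect (sE _ Ke) ye ze.
apply/and3P; split.
- apply/andP; split; first exact: connected_class_vertices.
  by apply/subsetP=> e; rewrite inE => /andP[].
- have from_x (y : T) : y \in connected_class x ->
      connect (shadow (component_at x)) x y.
    rewrite inE => /connectP[p xp ->].
    elim/last_ind: p xp => [|p z IH] //=; rewrite rcons_path last_rcons.
    case/andP=> xp lz; apply: connect_trans (IH xp) _.
    apply: connect1; case/shadowP: lz => ne [e He /andP[le ze]].
    apply/shadowP; split=> //; exists e; last by rewrite le.
    rewrite inE He; apply: (connected_class_edge He le).
    by rewrite inE; apply/connectP; exists p.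
  apply/forall_inP=> y yx; apply/forall_inP=> z zx.
  apply: connect_trans (from_x z zx).
  rewrite sym_connect_sym; last exact: shadow_sym.
  exact: from_x.
apply/forallP=> L; apply/implyP=> /and3P[LH conL /andP[vL eL]].
have xL : x \in vertices L by apply: (subsetP vL); rewrite inE connect0.
have EV : vertices L = connected_class x.
  apply/eqP; rewrite eqEsubset [X in _ && X]vL andbT; apply/subsetP=> y yL.
  by rewrite inE; apply: (sub_con L LH);
    move/forall_inP: conL => /(_ x xL)/forall_inP; apply.
apply/eqP/val_inj; rewrite /= [val L]surjective_pairing; congr (_, _) => //.
apply/eqP; rewrite eqEsubset [X in _ && X]eL andbT; apply/subsetP=> e Le.
rewrite inE; case/andP: LH => _ /subsetP -> //=; rewrite -EV.
by apply: subset_trans (hgvalP L); apply: bigcup_sup Le.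
Qed.

End Components.

(** The 1 accounts for a vertex in no edge of color [i]: it lies in no component counted by [mc],
    and its class is a singleton. *)
Lemma card_connected_class (T : finType) (G : hypergraph T) (r : nat)
    (chi : coloring r G) (i : 'I_r) (x : T) :
  #|connected_class (color_subhypergraph chi i) x| <= maxn (mc chi) 1.
Proof.
set H := color_subhypergraph chi i.
have [xH|xH] := boolP (x \in vertices H).
  rewrite leq_max; apply/orP; left; rewrite /mc.
  rewrite (bigD1 i) //= leq_max; apply/orP; left.
  rewrite (bigD1 (component_at H x)) /= ?leq_max ?leqnn //.
  exact: component_atP.
rewrite leq_max -(cards1 x) subset_leq_card ?orbT //.
apply/subsetP=> y; rewrite !inE => /connectP[[|z p] /= xp ->] //.
case/andP: xp => /shadowP[_ [e He /andP[xe _]]].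
by case/negP: xH; apply: (subsetP (edge_vertices He)).
Qed.

(** Coordinate [i] of [c x] records the side of the color-[i] component of [x]; an edge of color [i]
    lies inside one such component. *)
Lemma two_sided_cells (T : finType) (G : hypergraph T) (r : nat)
    (chi : coloring r G) (b : nat) :
    mc chi <= b -> 0 < b -> 2 * #|vertices G| <= 3 * b ->
  exists c : T -> {ffun 'I_r -> bool},
    (forall e, e \in edges G ->
       exists i, forall x y, x \in e -> y \in e -> c x i = c y i) /\
    (forall i s, #|[set v in vertices G | c v i == s]| <= b).
Proof.
move=> mcb b0 Vb; pose H i := color_subhypergraph chi i.
pose lab i x := fingraph.root (shadow (H i)) x.
have labE i : forall x y, (lab i x == lab i y) = connect (shadow (H i)) x y.
  by apply: root_connect; apply: sym_connect_sym; apply: shadow_sym.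
have small i a : #|[set v in vertices G | lab i v == a]| <= b.
  have [->|/set0Pn[x]] := eqVneq [set v in vertices G | lab i v == a] set0.
    by rewrite cards0.
  rewrite !inE => /andP[_ /eqP <-].
  apply: (@leq_trans (maxn (mc chi) 1)); last by rewrite geq_max mcb.
  apply: leq_trans (card_connected_class chi i x).
  apply/subset_leq_card/subsetP=> y.
  by rewrite !inE => /andP[_]; rewrite eq_sym labE.
have [p pP] : exists p : 'I_r -> T -> bool,
    forall i s, #|[set v in vertices G | p i (lab i v) == s]| <= b.
  suff /fin_all_exists[p pP] : forall i : 'I_r, exists p : T -> bool,
      forall s, #|[set v in vertices G | p (lab i v) == s]| <= b by exists p.
  by move=> i; apply: bisect_labels.
exists (fun v => [ffun i => p i (lab i v)]); split; last first.
  move=> i s; apply: leq_trans (pP i s); apply: eq_leq; apply: eq_card => v.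
  by rewrite !inE ffunE.
move=> e eG; pose e' : {e | e \in edges G} := exist _ e eG.
exists (chi e') => x y xe ye; rewrite !ffunE; congr (p _ _); apply/eqP.
rewrite labE; apply: (edge_connect (e := e)) => //.
by apply/imsetP; exists e'; rewrite ?inE.
Qed.

(** * Counting tuples with repeated entries *)

Lemma ffact_expn n k : n ^_ k <= n ^ k.
Proof.
have := card_inj_ffuns 'I_k 'I_n; rewrite !card_ord => <-.
by apply: leq_trans (max_card _) _; rewrite card_ffun !card_ord.
Qed.

(** The gap counts [k]-tuples with a repetition. Entry [j + 1] repeats one of the [j] before it in
    at most [j * n ^ k.-1] tuples; summing over [j] stays below the square. *)
Lemma expn_ffact n k : n ^ k <= n ^_ k + k ^ 2 * n ^ k.-1.
Proof.
elim: k => [|k IH]; first by rewrite expn0 ffactn0.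
case: k => [|k] in IH *; first by rewrite ffactn1; lia.
rewrite ffactnSr expnSr /=.
have le_f := ffact_expn n k.+1.
have : n ^ k.+1 * n <= (n ^_ k.+1 + k.+1 ^ 2 * n ^ k.+1.-1) * n.
  by rewrite leq_mul2r IH orbT.
rewrite mulnDl -mulnA -[n ^ k.+1.-1 * n]expnSr /=.
have sub : n ^_ k.+1 * n <= n ^_ k.+1 * (n - k.+1) + n ^_ k.+1 * k.+1.
  by rewrite -mulnDr leq_mul2l; apply/orP; right; lia.
have mono : n ^_ k.+1 * k.+1 <= n ^ k.+1 * k.+1 by rewrite leq_mul2r le_f orbT.
rewrite (_ : k.+2 ^ 2 = k.+1 ^ 2 + k.+1 + k.+2); last by lia.
set X := n ^ k.+1 in mono sub le_f *; set Y := n ^_ _ in mono sub le_f *.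
by rewrite !mulnDl; move: (_ ^ 2 * X) (n ^ k.+2) => Z W; lia.
Qed.

(** * Popular words and edge density *)

Section Cells.
Variables (T : finType) (G : hypergraph T) (I : finType).
Variable c : T -> {ffun I -> bool}.

Definition cell (w : {ffun I -> bool}) : {set T} :=
  [set v in vertices G | c v == w].

Definition popular (R : realType) (delta : R) : {set {ffun I -> bool}} :=
  [set w | (delta * #|vertices G|%:R <= #|cell w|%:R :> R)%R].

Section NoSplitPopular.
Variables (R : realType) (delta : R).
Hypothesis delta0 : (0 < delta)%R.
Let P := [set v in vertices G | c v \in popular delta].
Local Open Scope ring_scope.

(** There are [2 ^ #|I|] words, and each unpopular cell has fewer than [delta * n] vertices. *)
Lemma card_popular :
  #|vertices G|%:R - 2 ^+ #|I| * delta * #|vertices G|%:R <= #|P|%:R :> R.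
Proof.
set n := #|vertices G|.
have cells (Q : {set {ffun I -> bool}}) :
    \sum_(w in Q) #|cell w| = #|[set v in vertices G | c v \in Q]|.
  rewrite -sum1_card (partition_big c (mem Q)) /=; last first.
    by move=> v; rewrite inE => /andP[].
  apply: eq_bigr => w Qw; rewrite -sum1_card; apply: eq_bigl => v.
  by rewrite !inE; case: eqP => [->|]; rewrite ?Qw ?andbT ?andbF.
have nE : n = (#|P| + \sum_(w in ~: popular delta) #|cell w|)%N.
  rewrite cells.
  apply: etrans (esym (cardsID [set v | c v \in popular delta] _)) _.
  congr (_ + _)%N; apply: eq_card => v; rewrite !inE //.
  by rewrite andbC.
rewrite lerBlDr {1}nE natrD lerD2l natr_sum.
apply: (@le_trans _ _ (\sum_(w in ~: popular delta) delta * n%:R)).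
  by apply: ler_sum => w; rewrite !inE -ltNge => /ltW.
rewrite sumr_const -[leLHS]mulr_natl -[leRHS]mulrA; apply: ler_wpM2r.
  by rewrite mulr_ge0 // ltW.
by rewrite -natrX ler_nat -card_bool -card_ffun max_card.
Qed.

(** Popular words agreeing at [i] would put all popular vertices on one side, which is too small by
    [card_popular]. *)
Lemma popular_nonconstant b :
    (forall i s, #|[set v in vertices G | c v i == s]| <= b)%N ->
    b%:R + 2 ^+ #|I| * delta * #|vertices G|%:R < #|vertices G|%:R ->
  nonconstant (popular delta).
Proof.
move=> sides lt i s.
have [/exists_inP[z Cz /eqP zi]|none] :=
  boolP [exists z in popular delta, z i == s]; first by exists z.
have leP : (#|P| <= b)%N.
  apply: leq_trans (sides i (~~ s)); apply/subset_leq_card/subsetP=> v.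
  rewrite /P in_set => /andP[Vv Cv]; rewrite inE Vv /=.
  have : c v i != s.
    by apply: contra none => cs; apply/exists_inP; exists (c v).
  by case: (c v i) s {none} => [] [].
have := card_popular; have : #|P|%:R <= b%:R :> R by rewrite ler_nat.
by move: (2 ^+ _ * _ * _) lt => z; lra.
Qed.

(** With [k] colors the diameter bound is 1, so the popular words cannot be nonconstant, and the
    size condition of [popular_nonconstant] must fail. *)
Lemma sides_large_when_few_colors k b :
    (1 < k)%N -> #|I| = k ->
    (forall w : {ffun 'I_k -> {ffun I -> bool}},
       (forall j, w j \in popular delta) -> ~ splits w) ->
    (forall i s, #|[set v in vertices G | c v i == s]| <= b)%N ->
  #|vertices G|%:R <= b%:R + 2 ^+ #|I| * delta * #|vertices G|%:R.
Proof.
move=> k1 Ik nosplit sides; rewrite leNgt; apply/negP=> lt.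
have ncC := popular_nonconstant sides lt.
apply: (diameter1_not_nonconstant _ _ ncC); first by rewrite Ik.
move=> x y Cx Cy; apply: leq_trans (no_split_diameter k1 ncC nosplit Cx Cy) _.
by rewrite Ik subSnn.
Qed.

(** With [k + 1] colors the diameter bound is 2, and [2 < k] supplies the four coordinates that
    [diameter2_ball] needs. *)
Lemma sides_large_when_one_more_color k b :
    (2 < k)%N -> #|I| = k.+1 ->
    (forall w : {ffun 'I_k -> {ffun I -> bool}},
       (forall j, w j \in popular delta) -> ~ splits w) ->
    (forall i s, #|[set v in vertices G | c v i == s]| <= b)%N ->
  k%:R / k.+1%:R * #|vertices G|%:R
    <= b%:R + 2 ^+ #|I| * delta * #|vertices G|%:R.
Proof.
set n := #|vertices G| => k2 Ik nosplit sides; set z := 2 ^+ _ * _ * _.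
rewrite leNgt; apply/negP=> lt.
have n0 : 0 <= n%:R :> R by [].
have z0 : 0 <= z by rewrite /z !mulr_ge0 ?exprn_ge0 // ltW.
have ncC : nonconstant (popular delta).
  apply: popular_nonconstant sides _; apply: lt_le_trans lt _.
  by rewrite ler_piMl // ler_pdivrMr ?ltr0n // mul1r ler_nat.
have [|x y Cx Cy|w0 ball] := diameter2_ball _ ncC; first by rewrite Ik.
  apply: leq_trans (no_split_diameter (ltnW k2) ncC nosplit Cx Cy) _.
  by rewrite Ik; lia.
(* Each popular vertex deviates from [w0] in at most one coordinate, so summing over the coordinates
   gives [k.+1 * #|P| <= k.+1 * b + #|P|]. *)
have main : (k * #|P| <= k.+1 * b)%N.
  have sumP : (\sum_(i : I) #|[set v in P | c v i != w0 i]| <= #|P|)%N.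
    rewrite -[leqRHS]sum1_card.
    under eq_bigr do rewrite -sum1dep_card big_mkcondr.
    rewrite exchange_big; apply: leq_sum => v; rewrite /P in_set => /andP[_ Cv].
    by rewrite -big_mkcond sum1dep_card; apply: ball.
  have : (\sum_(i : I) #|P| <= \sum_(i : I) b +
      \sum_(i : I) #|[set v in P | c v i != w0 i]|)%N.
    rewrite -big_split; apply: leq_sum => i _.
    rewrite -(cardsID [set v | c v i == w0 i] P); apply: leq_add.
      apply: leq_trans (sides i (w0 i)); apply/subset_leq_card/subsetP=> v.
      by rewrite !inE => /andP[/andP[-> _] ->].
    apply: eq_leq; apply: eq_card => v; rewrite !inE.
    by rewrite andbC.
  rewrite !sum_nat_const cardT -cardE Ik; lia.
have := card_popular; rewrite -/n -/z => cP.
have {}main : k%:R * #|P|%:R <= k.+1%:R * b%:R :> R.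
  by rewrite -!natrM ler_nat.
have lt' : (k%:R + 1) * (b%:R + z) < k%:R * n%:R :> R.
  have k1 : 0 < k%:R + 1 :> R by rewrite natr1 ltr0n.
  rewrite (_ : k%:R * n%:R = (k%:R + 1) * (k%:R / k.+1%:R * n%:R)).
    by rewrite ltr_pM2l.
  by rewrite -natr1; field; rewrite gt_eqF.
(* [k * (n - z) <= k * #|P| <= k.+1 * b < k * n - k.+1 * z] contradicts [z >= 0]. *)
have : k%:R * (n%:R - z) <= k%:R * #|P|%:R by rewrite ler_wpM2l.
move: main lt'; rewrite -natr1 mulrBr !mulrDl !mul1r !mulrDr; lra.
Qed.
End NoSplitPopular.

Section Edges.
Variable k : nat.
Hypothesis unif : uniform k G.
Hypothesis c_edge : forall e, e \in edges G ->
  exists i, forall x y, x \in e -> y \in e -> c x i = c y i.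

Lemma edges_draws :
  edges G \subset [set e : {set T} | e \subset vertices G & #|e| == k].
Proof.
apply/subsetP=> e eG; rewrite inE edge_vertices //=.
exact: (forall_inP unif).
Qed.

Lemma card_edges_le : #|edges G| <= 'C(#|vertices G|, k).
Proof. by rewrite -cards_draws subset_leq_card ?edges_draws. Qed.

(** The product counts tuples with one vertex from each cell. An injective one has as image a
    [k]-set that is not an edge, and each such set arises from at most [k ^ k] tuples; the others
    are bounded by [expn_ffact]. *)
Lemma split_cells_le (w : {ffun 'I_k -> {ffun I -> bool}}) :
    splits w ->
  \prod_(j < k) #|cell (w j)| <=
    ('C(#|vertices G|, k) - #|edges G|) * k ^ k + k ^ 2 * #|vertices G| ^ k.-1.
Proof.
move=> w_split; set V := vertices G; set n := #|V|.
pose N := [set e : {set T} | e \subset V & #|e| == k] :\: edges G.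
have cardN : #|N| = 'C(n, k) - #|edges G|.
  by rewrite cardsDS ?edges_draws // cards_draws.
pose Fam := [set t in family (fun j : 'I_k => mem (cell (w j)))].
have -> : \prod_(j < k) #|cell (w j)| = #|Fam|.
  by rewrite cardsE card_family foldrE big_map big_enum.
pose Inj : {set {ffun 'I_k -> T}} := [set t in ffun_on (mem V) | injectiveb t].
pose All : {set {ffun 'I_k -> T}} := [set t in ffun_on (mem V)].
pose On (e : {set T}) : {set {ffun 'I_k -> T}} := [set t in ffun_on (mem e)].
have sub : Fam \subset (\bigcup_(e in N) On e) :|: (All :\: Inj).
  apply/subsetP=> t; rewrite inE => /familyP tF.
  have tV j : t j \in V by have := tF j; rewrite !inE => /andP[].
  have tc j : c (t j) = w j by have := tF j; rewrite !inE => /andP[_ /eqP].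
  have tVb : t \in ffun_on (mem V) by apply/ffun_onP.
  rewrite in_setU in_setD [t \in Inj]inE [t \in All]inE tVb andbT /=.
  case: (boolP (injectiveb t)) => [/injectiveP t_inj|_]; last by rewrite orbT.
  rewrite orbF; apply/bigcupP; exists (t @: 'I_k).
    rewrite !inE card_imset // card_ord eqxx andbT; apply/andP; split.
      apply/negP=> /c_edge[i ci]; have [j [j' /eqP[]]] := w_split i.
      by rewrite -!tc; apply: ci; apply: imset_f.
    by apply/subsetP=> _ /imsetP[j _ ->].
  by rewrite inE; apply/ffun_onP=> j; apply: imset_f.
apply: leq_trans (subset_leq_card sub) _.
apply: leq_trans (leq_card_setU _ _) _; apply: leq_add.
  rewrite -cardN -sum_nat_const.
  apply: (@leq_trans (\sum_(e in N) #|On e|)).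
    elim/big_rec2: _ => [|e m A _ le]; first by rewrite cards0.
    by apply: leq_trans (leq_card_setU _ _) _; rewrite leq_add2l.
  apply: leq_sum => e; rewrite !inE => /and3P[_ _ /eqP ek].
  by rewrite cardsE card_ffun_on ek card_ord.
have card_All : #|All| = n ^ k by rewrite cardsE card_ffun_on card_ord.
have card_Inj : #|Inj| = n ^_ k by rewrite card_inj_ffuns_on card_ord.
rewrite cardsDS; last by apply/subsetP=> t; rewrite !inE => /andP[].
by rewrite card_All card_Inj leq_subLR expn_ffact.
Qed.

Local Open Scope ring_scope.

(** Splitting popular words would yield at least [(delta * n) ^ k] tuples. By density, tuples from
    missing edges account for less than half of these; by the size of [n], tuples with a repetition
    for at most half. *)
Lemma popular_no_split (R : realType) (delta : R)
    (w : {ffun 'I_k -> {ffun I -> bool}}) :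
    0 < delta -> (0 < k)%N -> 2 * k%:R ^+ 2 <= delta ^+ k * #|vertices G|%:R ->
    (1 - delta ^+ k / (2 * k%:R ^+ k)) * 'C(#|vertices G|, k)%:R
      < #|edges G|%:R ->
    (forall j, w j \in popular delta) -> ~ splits w.
Proof.
set n := #|vertices G| => delta0 k0 large dense wP /split_cells_le.
set Ck := 'C(n, k) => le.
have lower : (delta * n%:R) ^+ k <= (\prod_(j < k) #|cell (w j)|)%:R :> R.
  rewrite natr_prod -[k in _ ^+ k]card_ord -prodr_const.
  apply: ler_prod => j _; rewrite mulr_ge0 ?(ltW delta0) //=.
  by have := wP j; rewrite inE.
have {le} : (delta * n%:R) ^+ k <=
    (Ck%:R - #|edges G|%:R) * k%:R ^+ k + k%:R ^+ 2 * n%:R ^+ k.-1 :> R.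
  apply: le_trans lower _; rewrite -(natrB _ card_edges_le) -!natrX.
  by rewrite -!natrM -natrD ler_nat.
have Ck_le : Ck%:R <= n%:R ^+ k :> R.
  rewrite -natrX ler_nat; apply: leq_trans (ffact_expn n k).
  by rewrite -bin_ffact leq_pmulr ?fact_gt0.
have kk0 : 0 < k%:R ^+ k :> R by rewrite exprn_gt0 ?ltr0n.
set D := delta ^+ k in dense large *.
have D0 : 0 < D by rewrite exprn_gt0.
have missing : (Ck%:R - #|edges G|%:R) * k%:R ^+ k < D / 2 * n%:R ^+ k.
  have lt : Ck%:R - #|edges G|%:R < D / (2 * k%:R ^+ k) * Ck%:R by lra.
  apply: (@lt_le_trans _ _ (D / (2 * k%:R ^+ k) * Ck%:R * k%:R ^+ k)).
    by rewrite ltr_pM2r.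
  rewrite (_ : _ * _ = D / 2 * Ck%:R); last by field; rewrite gt_eqF.
  by rewrite ler_pM2l // divr_gt0.
have nk : n%:R ^+ k = n%:R * n%:R ^+ k.-1 :> R by rewrite -exprS prednK.
have : 2 * k%:R ^+ 2 * n%:R ^+ k.-1 <= D * n%:R ^+ k :> R.
  by rewrite nk mulrA ler_wpM2r // exprn_ge0.
rewrite exprMn -/D; lra.
Qed.
End Edges.
End Cells.

(** * Choice of constants and conclusion *)

Lemma leq_mc_min (R : realType) (T : finType) (G : hypergraph T) (r : nat)
    (a : R) :
    (a <= #|vertices G|%:R)%R ->
    (forall chi : coloring r G, (a <= (mc chi)%:R)%R) ->
  (a <= (mc_min r G)%:R)%R.
Proof.
move=> aV achi; rewrite /mc_min; elim/big_ind: _ => // m1 m2.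
by rewrite /minn; case: ifP.
Qed.

Local Open Scope ring_scope.

(* [z] bounds the number of vertices in unpopular cells. *)
Lemma mc_large (R : realType) (T : finType) (G : hypergraph T) (r n : nat)
    (theta beta z : R) (chi : coloring r G) :
    #|vertices G| = n -> (25 <= n)%N -> 3 / 4 <= theta -> beta <= 1 / 24 ->
    z < beta * n%:R ->
    (forall (c : T -> {ffun 'I_r -> bool}) (b : nat),
       (forall e, e \in edges G ->
          exists i, forall x y, x \in e -> y \in e -> c x i = c y i) ->
       (forall i s, #|[set v in vertices G | c v i == s]| <= b)%N ->
       theta * n%:R <= b%:R + z) ->
  (theta - beta) * n%:R <= (mc chi)%:R.
Proof.
move=> Vn n25 theta_ge beta_le zlt big; rewrite leNgt; apply/negP=> lt.
(* The second term secures [2 * n <= 3 * b] for the bisection. It is at most [2 / 3 * n + 1], which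
   is below [(3 / 4 - 1 / 24) * n] once [n > 24]. *)
pose b := maxn (mc chi) ((2 * n) %/ 3).+1.
have [|||c [c_edge sides]] := @two_sided_cells _ _ _ chi b.
- exact: leq_maxl.
- by rewrite leq_max orbT.
- by rewrite Vn; have := leq_maxr (mc chi) ((2 * n) %/ 3).+1; rewrite -/b; lia.
have := big c b c_edge sides.
have n25' : 25 <= n%:R :> R by rewrite ler_nat.
have th : 3 / 4 * n%:R <= theta * n%:R by rewrite ler_wpM2r.
have be : beta * n%:R <= 1 / 24 * n%:R by rewrite ler_wpM2r.
have third : 3 * ((2 * n) %/ 3).+1%:R <= 2 * n%:R + 3 :> R.
  by rewrite -!natrM -natrD ler_nat; lia.
rewrite mulrBl in lt.
have : b%:R < theta * n%:R - beta * n%:R by rewrite /b /maxn; case: ifP => _; lra.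
lra.
Qed.

Theorem theorem1p3 (R : realType) (alpha : R) (k : nat)
    (halpha : 0 < alpha) (hk : (3 <= k)%N) :
  exists (eps : R) (n0 : nat), 0 < eps /\
    forall (T : finType) (G : hypergraph T) (n : nat),
      #|vertices G| = n -> (n0 <= n)%N -> uniform k G ->
      (1 - eps) * 'C(n, k)%:R < #|edges G|%:R ->
      (1 - alpha) * n%:R <= (mc_min k G)%:R /\
      (k%:R / k.+1%:R - alpha) * n%:R <= (mc_min k.+1 G)%:R.
Proof.
pose beta : R := Num.min alpha (1 / 24).
have beta0 : 0 < beta by rewrite lt_min halpha; lra.
have beta_alpha : beta <= alpha by rewrite ge_min lexx.
have beta24 : beta <= 1 / 24 by rewrite ge_min lexx orbT.
(* The at most [2 ^ k.+1] unpopular cells then hold fewer than [beta * n] vertices together, for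
   either number of colors. *)
pose delta : R := beta / 2 ^+ k.+2.
have delta0 : 0 < delta by rewrite divr_gt0 // exprn_gt0.
exists (delta ^+ k / (2 * k%:R ^+ k)).
exists (maxn 25 (Num.bound (2 * k%:R ^+ 2 / delta ^+ k))); split.
  by rewrite divr_gt0 ?mulr_gt0 ?exprn_gt0 // ltr0n; lia.
move=> T G n Vn; rewrite geq_max => /andP[n25 n_large] unif dense.
have large : 2 * k%:R ^+ 2 <= delta ^+ k * n%:R.
  rewrite [leRHS]mulrC -ler_pdivrMr ?exprn_gt0 //.
  apply: (@le_trans _ _ (Num.bound (2 * k%:R ^+ 2 / delta ^+ k))%:R).
    by apply/ltW/archi_boundP; rewrite divr_ge0 ?mulr_ge0 ?exprn_ge0 // ltW.
  by rewrite ler_nat.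
have n0 : 0 < n%:R :> R by rewrite ltr0n; lia.
have delta_small r : (r <= k.+1)%N -> 2 ^+ r * delta * n%:R < beta * n%:R.
  move=> rk; rewrite ltr_pM2r // /delta mulrCA gtr_pMr //.
  by rewrite ltr_pdivrMr ?exprn_gt0 // mul1r ltr_eXn2l ?ltr1n.
subst n.
have nosplit r (c : T -> {ffun 'I_r -> bool}) c_edge w :=
  @popular_no_split T G _ c k unif c_edge R delta w delta0
    (ltnW (ltnW hk)) large dense.
have shift (theta : R) r : theta <= 1 ->
    (forall chi : coloring r G,
      (theta - beta) * #|vertices G|%:R <= (mc chi)%:R) ->
    (theta - alpha) * #|vertices G|%:R <= (mc_min r G)%:R.
  move=> theta1 le_mc; apply: leq_mc_min.
    by rewrite ler_piMl //; lra.
  by move=> chi; apply: le_trans (le_mc chi); rewrite ler_pM2r // lerD2l lerN2.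
split; apply: shift => [|chi] //.
- apply: (mc_large (z := 2 ^+ k * delta * #|vertices G|%:R)) => //; first lra.
    exact: delta_small.
  move=> c b c_edge sides; rewrite mul1r -[X in 2 ^+ X]card_ord.
  apply: (sides_large_when_few_colors delta0 _ _ (nosplit _ c c_edge)) => //.
    exact: ltnW.
  by rewrite card_ord.
- by rewrite ler_pdivrMr ?ltr0n // mul1r ler_nat.
apply: (mc_large (z := 2 ^+ k.+1 * delta * #|vertices G|%:R)) => //.
(* [3 / 4 <= k / (k + 1)] is equivalent to [3 <= k]. *)
- rewrite ler_pdivlMr ?ltr0n //.
  have : 3 <= k%:R :> R by rewrite ler_nat.
  by rewrite -natr1; lra.
- exact: delta_small.
move=> c b c_edge sides; rewrite -[X in 2 ^+ X]card_ord.
apply: (sides_large_when_one_more_color delta0 _ _ (nosplit _ c c_edge)) => //.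
by rewrite card_ord.
Qed.
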